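(* Let $\Sigma^{\otimes_1^n}=\Sigma_1\times\cdots\times\Sigma_n$ be a set of sequences, and for each site $i$ let $(P_i^t)_t$ be the transition probabilities of an irreducible, time-reversible Markov process on the finite alphabet $\Sigma_i$ (time $t$ ranging over $\mathbb{R}^+$ or $\mathbb{Z}^+$) with stationary distribution $\pi_i$. For sequences $x,y$ put $P^t(x,y)=\prod_{i=1}^nP_i^t(x[i],y[i])$ and $\pi(x)=\prod_{i=1}^n\pi_i(x[i])$. Let $T=(V(T),E(T))$ be a directed tree (edges oriented away from its root $\mathrm{root}(T)$) with a labeling $\lambda:V(T)\to\Sigma^{\otimes_1^n}$, and define $\phi(v)=-\log\pi(\lambda(v))$, $\phi(u,v)=-\log\sup_tP^t(\lambda(u),\lambda(v))$, and the cost $\phi(T)=\phi(\mathrm{root}(T))+\sum_{(u,v)\in E(T)}\phi(u,v)$. Then $$\phi(T)=\sum_{(u,v)\in E(T)}w'(u,v)+\sum_{v\in V(T)}\phi(v),$$ where $w'(u,v):=\tfrac12\big(\phi(u,v)+\phi(v,u)-\phi(u)-\phi(v)\big)$ (which is symmetric in $u,v$).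
   Context: Time-reversibility of site $i$ means $\pi_i(a)P_i^t(a,b)=\pi_i(b)P_i^t(b,a)$ for all $a,b\in\Sigma_i$ and all $t$; irreducibility means every state is reachable from every other state. The supremum over $t$ is over the time domain of the model. *)

(* Defs.v *)
From HB Require Import structures.
From mathcomp Require Import all_boot all_order all_algebra.
From mathcomp Require Import all_classical all_reals all_analysis.

Set Implicit Arguments.
Unset Strict Implicit.
Unset Printing Implicit Defensive.

Import Order.TTheory GRing.Theory Num.Theory.

Local Open Scope classical_set_scope.
Local Open Scope ring_scope.

(* Time ranges over the nonnegative/positive reals or the nonnegative/positive
   integers; all four readings of "R^+ or Z^+" are admitted. *)
Definition time_domain (R : realType) (D : set R) : Prop :=
  [\/ D = [set t | 0 <= t],
      D = [set t | 0 < t],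
      D = [set k%:R | k in [set: nat]] |
      D = [set k.+1%:R | k in [set: nat]]].

Section OneSite.
Variables (R : realType) (D : set R) (S : finType).
Variables (P : R -> S -> S -> R) (mu : S -> R).

(* Only the values P t with t in D matter. The condition at time 0 is vacuous
   when 0 is not in D. *)
Definition transition_probabilities : Prop :=
  [/\ forall t, D t -> forall a b, 0 <= P t a b,
      forall t, D t -> forall a, \sum_b P t a b = 1,
      D 0 -> forall a b, P 0 a b = (a == b)%:R &
      forall s t, D s -> D t ->
        forall a b, P (s + t) a b = \sum_c P s a c * P t c b].

Definition irreducible_process : Prop :=
  forall a b, a != b -> exists2 t, D t & 0 < P t a b.

Definition stationary_distribution : Prop :=
  [/\ forall a, 0 <= mu a,
      \sum_a mu a = 1 &
      forall t, D t -> forall b, \sum_a mu a * P t a b = mu b].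

Definition time_reversible : Prop :=
  forall t, D t -> forall a b, mu a * P t a b = mu b * P t b a.

End OneSite.

Section Tree.
Variable V : finType.

Definition underlying (E : rel V) : rel V := [rel u v | E u v || E v u].

(* x :: p is the sequence of vertices of a simple path from x to y. *)
Definition simple_path (e : rel V) (x y : V) (p : seq V) : Prop :=
  [/\ path e x p, last x p = y & uniq (x :: p)].

Definition is_tree (e : rel V) : Prop :=
  [/\ symmetric e, irreflexive e &
      forall x y, exists! p, simple_path e x y p].

(* An edge (u, v) points away from the root when u lies on the path of the
   underlying tree from the root to v. *)
Definition directed_tree (E : rel V) (root : V) : Prop :=
  is_tree (underlying E) /\
  forall u v, E u v ->
    forall p, simple_path (underlying E) root v p -> u \in root :: p.

End Tree.

Section Cost.
Variables (R : realType) (n : nat) (Sigma : 'I_n -> finType).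

Definition sequences := {dffun forall i : 'I_n, Sigma i}.

Variables (D : set R) (P : forall i, R -> Sigma i -> Sigma i -> R).
Variable (mu : forall i, Sigma i -> R).

Definition seq_prob (t : R) (x y : sequences) : R :=
  \prod_(i < n) P t (x i) (y i).

Definition seq_stat (x : sequences) : R := \prod_(i < n) mu (x i).

Variables (V : finType) (lambda : V -> sequences).

Local Open Scope ereal_scope.

(* The costs are extended reals because -log 0 = +oo does occur for periodic
   discrete-time chains: the sites may be unable to reach their targets at a
   common time. *)
Definition phi_vertex (v : V) : \bar R := - lne (seq_stat (lambda v))%:E.

Definition phi_edge (u v : V) : \bar R :=
  - lne (ereal_sup [set (seq_prob t (lambda u) (lambda v))%:E | t in D]).

Definition phi_tree (E : rel V) (root : V) : \bar R :=
  phi_vertex root + \sum_(e : V * V | E e.1 e.2) phi_edge e.1 e.2.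

Definition w' (u v : V) : \bar R :=
  (2^-1)%:E *
  (phi_edge u v + phi_edge v u - phi_vertex u - phi_vertex v).

End Cost.

(* Main.v *)
Require Import Defs.
From mathcomp Require Import all_boot all_order all_algebra.
From mathcomp Require Import all_classical all_reals all_analysis.
From mathcomp Require Import ring.

(** Irreducibility and reversibility make the stationary weights positive, and
    taking suprema in the detailed balance equation gives
    [phi(u) + phi(u,v) = phi(v) + phi(v,u)], that is, [w'(u,v) = phi(u,v) - phi(v)].
    In a tree oriented away from its root every vertex but the root is the head
    of exactly one edge, so the terms [- phi(v)] summed over the edges cancel
    every [phi(v)] except that of the root. *)

Set Implicit Arguments.
Unset Strict Implicit.
Unset Printing Implicit Defensive.

Import Order.TTheory GRing.Theory Num.Theory.
Local Open Scope ring_scope.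

Lemma stationary_gt0 (R : realType) (D : set R) (S : finType)
    (P : R -> S -> S -> R) (mu : S -> R) (a : S) :
  irreducible_process D P -> stationary_distribution D P mu ->
  time_reversible D P mu -> 0 < mu a.
Proof.
move=> irr [mu_ge0 mu1 _] rev.
have [b mub] : exists b, 0 < mu b.
  apply: contrapT => /forallNP mu_le0.
  have := oner_neq0 R; rewrite -mu1 big1 ?eqxx// => b _.
  by apply/eqP; rewrite eq_le mu_ge0 leNgt andbT; apply/negP/mu_le0.
have [<-//|ba] := eqVneq b a.
have [t Dt Pt] := irr _ _ ba.
have : 0 < mu a * P t a b by rewrite -(rev t Dt) mulr_gt0.
move=> /lt0r_neq0 muP; rewrite lt0r mu_ge0 andbT.
by apply: contraNneq muP => ->; rewrite mul0r.
Qed.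

Lemma seq_stat_gt0 (R : realType) (n : nat) (Sigma : 'I_n -> finType)
    (D : set R) (P : forall i, R -> Sigma i -> Sigma i -> R)
    (mu : forall i, Sigma i -> R) (x : sequences Sigma) :
  (forall i, irreducible_process D (P i)) ->
  (forall i, stationary_distribution D (P i) (mu i)) ->
  (forall i, time_reversible D (P i) (mu i)) -> 0 < seq_stat mu x.
Proof.
move=> irr stat rev; apply: prodr_gt0 => i _.
exact: stationary_gt0 (irr i) (stat i) (rev i).
Qed.

Lemma seq_detailed_balance (R : realType) (n : nat) (Sigma : 'I_n -> finType)
    (D : set R) (P : forall i, R -> Sigma i -> Sigma i -> R)
    (mu : forall i, Sigma i -> R) (t : R) (x y : sequences Sigma) :
  (forall i, time_reversible D (P i) (mu i)) -> D t ->
  seq_stat mu x * seq_prob P t x y = seq_stat mu y * seq_prob P t y x.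
Proof.
by move=> rev Dt; rewrite -!big_split; apply: eq_bigr => i _; apply: rev.
Qed.

Lemma lne_pZl (R : realType) (r : R) (x : \bar R) :
  0 < r -> (lne (r%:E * x) = lne r%:E + lne x)%E.
Proof.
move=> r0; rewrite (lne_EFin r0); case: x => [s| |].
- rewrite -EFinM /lne pmulr_rle0//; case: ifPn => //.
  by rewrite -ltNge => s0; rewrite lnM.
- by rewrite gt0_muley.
- by rewrite gt0_muleNy.
Qed.

Lemma phi_vertex_fin_num (R : realType) (n : nat) (Sigma : 'I_n -> finType)
    (mu : forall i, Sigma i -> R) (V : finType) (lambda : V -> sequences Sigma)
    (v : V) :
  0 < seq_stat mu (lambda v) -> (phi_vertex mu lambda v \is a fin_num)%E.
Proof. by move=> v0; rewrite /phi_vertex lne_EFin. Qed.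

Lemma phi_edge_balance (R : realType) (n : nat) (Sigma : 'I_n -> finType)
    (D : set R) (P : forall i, R -> Sigma i -> Sigma i -> R)
    (mu : forall i, Sigma i -> R) (V : finType) (lambda : V -> sequences Sigma)
    (u v : V) :
  (forall x, 0 < seq_stat mu x) ->
  (forall i, time_reversible D (P i) (mu i)) ->
  (phi_vertex mu lambda u + phi_edge D P lambda u v =
   phi_vertex mu lambda v + phi_edge D P lambda v u)%E.
Proof.
move=> mu0 rev; rewrite /phi_vertex /phi_edge.
have fin x : lne (seq_stat mu x)%:E \is a fin_num by rewrite lne_EFin.
rewrite addeC [RHS]addeC -!fin_num_oppeD//; congr (- _)%E.
rewrite addeC [RHS]addeC -!lne_pZl// -!ereal_sup_pZl//.
congr (lne (ereal_sup _)); rewrite !image_comp.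
by apply: eq_imagel => t Dt; rewrite /= -!EFinM (seq_detailed_balance _ _ rev).
Qed.

Lemma w'E (R : realType) (n : nat) (Sigma : 'I_n -> finType)
    (D : set R) (P : forall i, R -> Sigma i -> Sigma i -> R)
    (mu : forall i, Sigma i -> R) (V : finType) (lambda : V -> sequences Sigma)
    (u v : V) :
  (forall x, 0 < seq_stat mu x) ->
  (forall i, time_reversible D (P i) (mu i)) ->
  (w' D P mu lambda u v = phi_edge D P lambda u v - phi_vertex mu lambda v)%E.
Proof.
move=> mu0 rev; have := phi_edge_balance lambda u v mu0 rev; rewrite /w'.
have fin w : (phi_vertex mu lambda w \is a fin_num)%E by exact: phi_vertex_fin_num.
have := fin v; have := fin u.
case: (phi_vertex mu lambda u) => // a; case: (phi_vertex mu lambda v) => // b.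
move=> _ _; have half0 : 0 < (2^-1 : R) by rewrite invr_gt0.
case: (phi_edge D P lambda u v) => [r| |];
  case: (phi_edge D P lambda v u) => [s| |]//=; last 2 first.
- by rewrite gt0_muley.
- by rewrite gt0_muleNy.
by move=> [ars]; congr (_%:E); have -> : s = a + r - b by [rewrite ars; ring]; field.
Qed.

Lemma no_edge_to_root (V : finType) (E : rel V) (root u : V) :
  directed_tree E root -> E u root = false.
Proof.
move=> [[_ irrE _] away]; apply/negP => Eu.
have := away _ _ Eu [::] (And3 isT erefl isT); rewrite inE => /eqP u_root.
by have := irrE root; rewrite /underlying /= -{1}u_root Eu.
Qed.

Lemma unique_parent (V : finType) (E : rel V) (root v : V) :
  directed_tree E root -> v != root -> exists u, forall u', E u' v = (u' == u).
Proof.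
move=> [[symE irrE uniqE] away] v_root.
have [p [[pth lst unq] p_uniq]] := uniqE root v.
case/lastP: p pth lst unq p_uniq => [_ /= rv|p w]; first by rewrite rv eqxx in v_root.
rewrite rcons_path last_rcons -rcons_cons rcons_uniq.
move=> /andP[pth e_last] wv; rewrite {w}wv in e_last *.
move=> /andP[v_p unq] p_uniq; exists (last root p) => u.
have p_simple : simple_path (underlying E) root v (rcons p v).
  by split; rewrite ?rcons_path ?pth ?last_rcons// -rcons_cons rcons_uniq v_p.
apply/idP/eqP => [Euv|->]; last first.
  case/orP: e_last => // Ev; have := away _ _ Ev p (And3 pth erefl unq).
  by rewrite (negPf v_p).
have u_v : u != v.
  by apply: contraTneq Euv => ->; have := irrE v; rewrite /underlying /= orbb => ->.
have := away _ _ Euv _ p_simple.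
rewrite -rcons_cons mem_rcons inE (negPf u_v) /= => u_p.
case/splitPl: u_p pth unq v_p p_uniq {e_last p_simple} => p1 p2 lst1.
rewrite cat_path -cat_cons cat_uniq mem_cat negb_or.
move=> /andP[pth1 _] /andP[unq1 _] /andP[v_p1 _] p_uniq.
have : simple_path (underlying E) root v (rcons p1 v).
  split; rewrite ?last_rcons -?rcons_cons ?rcons_uniq ?v_p1//.
  by rewrite rcons_path pth1 lst1 /underlying /= Euv.
by move=> /p_uniq /rcons_inj[->].
Qed.

Lemma sum_over_heads (V : finType) (E : rel V) (root : V) (M : nmodType)
    (f : V -> M) :
  directed_tree E root ->
  \sum_(e : V * V | E e.1 e.2) f e.2 = \sum_(v | v != root) f v.
Proof.
move=> hT; rewrite -(pair_big_dep predT E (fun _ v => f v)) /=.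
rewrite (exchange_big_dep predT)//= (bigD1 root)//= big_pred0 ?add0r; last first.
  by move=> u; rewrite (no_edge_to_root _ hT).
apply: eq_bigr => v /(unique_parent hT)[u Eu].
by rewrite (big_pred1 u).
Qed.

Theorem theorem1 (R : realType) (n : nat) (Sigma : 'I_n -> finType)
    (D : set R) (P : forall i : 'I_n, R -> Sigma i -> Sigma i -> R)
    (mu : forall i : 'I_n, Sigma i -> R)
    (V : finType) (E : rel V) (root : V) (lambda : V -> sequences Sigma)
    (hD : time_domain D)
    (hP : forall i : 'I_n, transition_probabilities D (P i))
    (hirr : forall i : 'I_n, irreducible_process D (P i))
    (hstat : forall i : 'I_n, stationary_distribution D (P i) (mu i))
    (hrev : forall i : 'I_n, time_reversible D (P i) (mu i))
    (hT : directed_tree E root) :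
  phi_tree D P mu lambda E root =
    (\sum_(e : V * V | E e.1 e.2) w' D P mu lambda e.1 e.2
       + \sum_(v : V) phi_vertex mu lambda v)%E
  /\ (forall u v : V, w' D P mu lambda u v = w' D P mu lambda v u).
Proof.
have mu0 x : 0 < seq_stat mu x by apply: seq_stat_gt0 hirr hstat hrev.
have fin v : (phi_vertex mu lambda v \is a fin_num)%E by exact: phi_vertex_fin_num.
split=> [|u v]; last first.
  by rewrite /w' (addeC (phi_edge D P lambda u v)) addeAC.
under [in RHS]eq_bigr do rewrite w'E//.
rewrite big_split /= (sum_over_heads (fun v => - phi_vertex mu lambda v)%E hT).
rewrite (fin_num_sumeN _ (f := phi_vertex mu lambda))//.
rewrite [X in (_ = _ + X)%E](bigD1 root)//=.
rewrite addeCA -addeA (addeC (- _)%E) subee ?adde0//.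
by apply/sum_fin_numP => v _ _.
Qed.
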